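(* Let $\mathbf a=(a_n)_{n\ge0}$, $\mathbf b=(b_n)_{n\ge1}$, $\mathbf c=(c_n)_{n\ge1}$, $\mathbf d=(d_n)_{n\ge0}$, $\mathbf e=(e_n)_{n\ge0}$, $\mathbf f=(f_n)_{n\ge1}$, $\mathbf g=(g_n)_{n\ge0}$, $\mathbf h=(h_n)_{n\ge0}$ be indeterminates. Let $L_1$ be the lower-bidiagonal matrix with $a_0,a_1,\dots$ on the diagonal and $b_1,b_2,\dots$ on the subdiagonal; $U$ the upper-bidiagonal matrix with $d_0,d_1,\dots$ on the diagonal and $c_1,c_2,\dots$ on the superdiagonal; $L_2$ the lower-bidiagonal matrix with $e_0,e_1,\dots$ on the diagonal and $f_1,f_2,\dots$ on the subdiagonal; $D_1=\mathrm{diag}(g_0,g_1,\dots)$ and $D_2=\mathrm{diag}(h_0,h_1,\dots)$ (all matrices indexed by $\mathbb N\times\mathbb N$). Then the matrix $$P=L_1UL_2+L_1D_1+D_2L_2$$ is totally positive, coefficientwise in the indeterminates $\mathbf a,\mathbf b,\mathbf c,\mathbf d,\mathbf e,\mathbf f,\mathbf g,\mathbf h$.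
   Context: Coefficientwise total positivity: every minor is a polynomial with nonnegative coefficients in the indicated indeterminates. *)

(* Defs.v *)
From HB Require Import structures.
From mathcomp Require Import all_boot all_order all_algebra.
From mathcomp Require Import finmap monalg.
From mathcomp Require Import classical_sets fsbigop.

Set Implicit Arguments.
Unset Strict Implicit.
Unset Printing Implicit Defensive.

Import GRing.Theory Num.Theory.
Local Open Scope ring_scope.

Inductive family : Type := Fa | Fb | Fc | Fd | Fe | Ff | Fg | Fh.

Definition family_code (F : family) : nat :=
  match F with
  | Fa => 0 | Fb => 1 | Fc => 2 | Fd => 3 | Fe => 4 | Ff => 5 | Fg => 6 | Fh => 7
  end.

Definition family_decode (n : nat) : option family :=
  nth None [seq Some F | F <- [:: Fa; Fb; Fc; Fd; Fe; Ff; Fg; Fh]] n.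

Lemma family_codeK : pcancel family_code family_decode.
Proof. by case. Qed.

HB.instance Definition _ := Countable.copy family (pcan_type family_codeK).

(* The pair (F, n) is the n-th indeterminate of the sequence F.  The sequences
   b, c, f start at n = 1; their 0-th indeterminates exist in the ring but
   occur in none of the matrices below. *)
Notation indet := (family * nat)%type.

Notation Zpoly := {malg int[{cmonom indet}]}.

Definition X (F : family) (n : nat) : Zpoly := << ucm (F, n) >>.

Definition coefficientwise_nonneg (p : Zpoly) : Prop :=
  forall m : {cmonom indet}, 0 <= p@_m.

Definition infmx (R : Type) : Type := nat -> nat -> R.

Section InfiniteMatrices.
Variable R : pzRingType.
Implicit Types (A B : infmx R) (u v : nat -> R).

(* The sum ranges over the k with A i k * B k j <> 0; it is the usual product
   whenever these are finitely many, as for the banded matrices used here. *)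
Definition infmx_mul A B : infmx R :=
  fun i j => \sum_(k \in [set: nat]%classic) (A i k * B k j).

Definition infmx_add A B : infmx R := fun i j => A i j + B i j.

Definition infmx_diag u : infmx R := fun i j => if i == j then u i else 0.

(* Entry v_n sits in position (n, n - 1), for n >= 1. *)
Definition lower_bidiag u v : infmx R :=
  fun i j => if i == j then u i else if i == j.+1 then v i else 0.

(* Entry v_n sits in position (n - 1, n), for n >= 1. *)
Definition upper_bidiag u v : infmx R :=
  fun i j => if i == j then u i else if j == i.+1 then v j else 0.

Definition infmx_minor A (k : nat) (r c : 'I_k -> nat) : R :=
  \det (\matrix_(i < k, j < k) A (r i) (c j)).

End InfiniteMatrices.

Declare Scope infmx_scope.
Delimit Scope infmx_scope with IM.
Bind Scope infmx_scope with infmx.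
Infix "*" := infmx_mul : infmx_scope.
Infix "+" := infmx_add : infmx_scope.

Definition coefficientwise_totally_positive (A : infmx Zpoly) : Prop :=
  forall (k : nat) (r c : 'I_k -> nat),
    {homo r : i j / (i < j)%N} -> {homo c : i j / (i < j)%N} ->
    coefficientwise_nonneg (infmx_minor A r c).

(* Main.v *)
(* Interleaving rows and columns turns P into a product of banded matrices, each
   staircase-shaped: P = A K B, where A has row i equal to (b_i, h_i, a_i) in
   columns 2i-1, 2i, 2i+1 (the columns of D2 and L1 interleaved), B has column j
   equal to (e_j, g_j, f_{j+1}) in rows 2j, 2j+1, 2j+2 (the rows of L2 and D1
   interleaved), and K is the identity plus d_i in position (2i+1, 2i) and c_i
   in position (2i-1, 2i).  Multiplying a totally positive matrix by a
   staircase-shaped one with nonnegative entries preserves total positivity, by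
   multilinearity of the determinant. *)
From HB Require Import structures.
Require Import Defs.
From mathcomp Require Import all_boot all_order all_algebra all_fingroup.
From mathcomp Require Import finmap monalg.
From mathcomp Require Import classical_sets fsbigop.
From mathcomp Require Import zify ring.

Set Implicit Arguments.
Unset Strict Implicit.
Unset Printing Implicit Defensive.

Import Order.TTheory GRing.Theory Num.Theory.
Local Open Scope ring_scope.

(** [S] abstracts nonnegativity: the arguments below only use that it contains 0 and 1 and is closed
    under sums and products. *)
Definition totally_positive (R : pzRingType) (S : {pred R}) (A : infmx R)
    : Prop :=
  forall (k : nat) (r c : 'I_k -> nat),
    {homo r : i j / (i < j)%N} -> {homo c : i j / (i < j)%N} ->
    infmx_minor A r c \in S.

Definition infmx_tr (R : Type) (A : infmx R) : infmx R := fun i j => A j i.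

Lemma ltn_homo_leq k (s : 'I_k -> 'I_k) :
  {homo s : i j / (i < j)%N} -> forall i : 'I_k, (i <= s i)%N.
Proof.
move=> hs [n]; elim: n => //= n IHn ltnk.
have ltnk' := ltnW ltnk.
apply: leq_ltn_trans (IHn ltnk') (hs (Ordinal ltnk') (Ordinal ltnk) _).
exact: ltnSn.
Qed.

(** The inverse of [s] is increasing too, and an increasing self-map of ['I_k] never lies below the
    identity. *)
Lemma perm_ltn_homo k (s : 'S_k) : {homo s : i j / (i < j)%N} -> s = 1%g.
Proof.
move=> hs; have hsV : {homo (s^-1)%g : i j / (i < j)%N}.
  move=> i j ltij; case: ltngtP => // [/hs|/val_inj/perm_inj eij].
    by rewrite !permKV ltnNge (ltnW ltij).
  by rewrite eij ltnn in ltij.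
apply/permP => i; rewrite perm1; apply/val_inj/eqP; rewrite eqn_leq.
rewrite (ltn_homo_leq hs) andbT.
by have := ltn_homo_leq hsV (s i); rewrite permK.
Qed.

Section TotalPositivity.
Variables (R : comPzRingType) (S : semiringClosed R).
Implicit Types (A B : infmx R).

Lemma infmx_minor_tr A k (r c : 'I_k -> nat) :
  infmx_minor (infmx_tr A) r c = infmx_minor A c r.
Proof.
by rewrite /infmx_minor -det_tr; congr (\det _); apply/matrixP=> i j;
  rewrite !mxE.
Qed.

Lemma tp_tr A : totally_positive S A -> totally_positive S (infmx_tr A).
Proof. by move=> tpA k r c hr hc; rewrite infmx_minor_tr tpA. Qed.

(** A nonzero Leibniz term forces [r i = c (s i)] for all [i]; then [s] is increasing, hence the
    identity, of sign +1. *)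
Lemma tp_diag1 : totally_positive S (infmx_diag (fun=> 1)).
Proof.
move=> k r c hr hc; rewrite /infmx_minor /determinant; apply: rpred_sum => s _.
have [all_eq|] := boolP [forall i, r i == c (s i)]; last first.
  case/forallPn => i neq; rewrite (bigD1 i) //= !mxE /infmx_diag (negPf neq).
  by rewrite mul0r mulr0 rpred0.
have {}all_eq i : r i = c (s i) by apply/eqP/(forallP all_eq).
have -> : s = 1%g.
  apply: perm_ltn_homo => i j /hr; rewrite !all_eq => lt_c.
  case: ltngtP => // [/hc|/val_inj eij]; first by rewrite ltnNge (ltnW lt_c).
  by rewrite eij ltnn in lt_c.
rewrite odd_perm1 mul1r rpred_prod // => i _.
by rewrite !mxE /infmx_diag; case: ifP; rewrite ?rpred0 ?rpred1.
Qed.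

(* A weakly increasing column selection either is strictly increasing or
   repeats a column, in which case the minor vanishes. *)
Lemma tp_minor_weak A k (r c : 'I_k -> nat) : totally_positive S A ->
    {homo r : i j / (i < j)%N} ->
    (forall i j : 'I_k, (i < j)%N -> (c i <= c j)%N) ->
  infmx_minor A r c \in S.
Proof.
move=> tpA hr hc.
have [/injectiveP c_inj|] := boolP (injectiveb c).
  by apply: tpA => // i j ltij; rewrite ltn_neqAle hc // andbT (inj_eq c_inj)
    -val_eqE neq_ltn ltij.
case/injectivePn => i [j neq_ij eq_c].
rewrite /infmx_minor -det_tr (determinant_alternate neq_ij) ?rpred0 // => l.
by rewrite !mxE eq_c.
Qed.

(* Expanding each column gives a nonnegative combination of minors of [A]
   whose column selections are weakly increasing; this replaces Cauchy-Binet. *)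
Lemma tp_col_staircase (T : finType) (w : nat -> T -> R) (phi : nat -> T -> nat)
    A B :
    totally_positive S A -> (forall j t, w j t \in S) ->
    (forall j j' t t', (j < j')%N -> (phi j t <= phi j' t')%N) ->
    (forall i j, B i j = \sum_t w j t * A i (phi j t)) ->
  totally_positive S B.
Proof.
move=> tpA Sw hphi defB k r c hr hc.
suff -> : infmx_minor B r c = \sum_(f : {ffun 'I_k -> T})
    (\prod_j w (c j) (f j)) * infmx_minor A r (fun j => phi (c j) (f j)).
  apply: rpred_sum => f _; apply: rpredM; first exact: rpred_prod.
  by apply: tp_minor_weak => // i j /hc; apply: hphi.
(* After transposition the Leibniz products run over columns, so the weights of a choice [f] of one
   summand per column do not depend on the permutation and factor out. *)
rewrite -[LHS]infmx_minor_tr {1}/infmx_minor /determinant.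
under eq_bigr => s _.
  under eq_bigr => j _ do rewrite mxE /infmx_tr defB.
  rewrite bigA_distr_bigA mulr_sumr; over.
rewrite exchange_big; apply: eq_bigr => f _ /=.
rewrite -[in RHS]infmx_minor_tr /infmx_minor /determinant mulr_sumr.
apply: eq_bigr => s _; rewrite big_split /= mulrCA; congr (_ * (_ * _)).
by apply: eq_bigr => j _; rewrite mxE.
Qed.

Lemma tp_row_staircase (T : finType) (w : nat -> T -> R) (phi : nat -> T -> nat)
    A B :
    totally_positive S A -> (forall i t, w i t \in S) ->
    (forall i i' t t', (i < i')%N -> (phi i t <= phi i' t')%N) ->
    (forall i j, B i j = \sum_t w i t * A (phi i t) j) ->
  totally_positive S B.
Proof.
move=> tpA Sw hphi defB; apply: (@tp_tr (infmx_tr B)).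
by apply: (tp_col_staircase (tp_tr tpA) Sw hphi) => i j; rewrite -defB.
Qed.

End TotalPositivity.

Section BandedProducts.
Variable R : pzRingType.
Implicit Types (A B : infmx R) (u v : nat -> R).

Lemma infmx_mulE A B i j (s : seq nat) :
    uniq s -> (forall k, k \notin s -> A i k * B k j = 0) ->
  (A * B)%IM i j = \sum_(k <- s) A i k * B k j.
Proof.
move=> s_uniq s_supp; rewrite /infmx_mul (fsbigE s) //; last by move=> k _ /s_supp.
by apply: eq_bigl => k; rewrite in_setT.
Qed.

Lemma infmx_mul_diag A u i j : (A * infmx_diag u)%IM i j = A i j * u j.
Proof.
rewrite (@infmx_mulE _ _ _ _ [:: j]) // => [|k].
  by rewrite big_seq1 /infmx_diag eqxx.
by rewrite inE /infmx_diag => /negPf->; rewrite mulr0.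
Qed.

Lemma infmx_mul_lower A u v i j :
  (A * lower_bidiag u v)%IM i j = A i j * u j + A i j.+1 * v j.+1.
Proof.
rewrite (@infmx_mulE _ _ _ _ [:: j; j.+1]) => [||k].
- by rewrite !big_cons big_nil /lower_bidiag !eqxx addr0 gtn_eqF.
- by rewrite /= inE andbT ltn_eqF.
by rewrite !inE /lower_bidiag negb_or => /andP[/negPf-> /negPf->]; rewrite mulr0.
Qed.

Lemma infmx_mul_upper A u v i j :
  (A * upper_bidiag u v)%IM i j =
    A i j * u j + (if j is j'.+1 then A i j' * v j else 0).
Proof.
case: j => [|j].
  rewrite (@infmx_mulE _ _ _ _ [:: 0%N]) // => [|k].
    by rewrite big_seq1 addr0.
  by rewrite inE /upper_bidiag => /negPf->; rewrite mulr0.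
rewrite (@infmx_mulE _ _ _ _ [:: j.+1; j]) => [||k].
- by rewrite !big_cons big_nil /upper_bidiag !eqxx addr0 ltn_eqF.
- by rewrite /= inE andbT gtn_eqF.
rewrite !inE /upper_bidiag negb_or eqSS (eq_sym j) => /andP[/negPf-> /negPf->].
by rewrite mulr0.
Qed.

End BandedProducts.

Definition interleave (R : Type) (A B : infmx R) : infmx R :=
  fun i m => if odd m then B i m./2 else A i m./2.

Section Quadridiagonal.
Variables (R : comPzRingType) (S : semiringClosed R).
Variables a b c d e f g h : nat -> R.
Hypotheses (Sa : forall n, a n \in S) (Sb : forall n, b n \in S).
Hypotheses (Sc : forall n, c n \in S) (Sd : forall n, d n \in S).
Hypotheses (Se : forall n, e n \in S) (Sf : forall n, f n \in S).
Hypotheses (Sg : forall n, g n \in S) (Sh : forall n, h n \in S).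

Let L1 := lower_bidiag a b.
Let U := upper_bidiag d c.
Let L2 := lower_bidiag e f.

(* The interleaved matrix is A; for i = 0 the truncated index of column
   2i - 1 is given weight 0. *)
Lemma tp_interleave_diag_lower :
  totally_positive S (interleave (infmx_diag h) L1).
Proof.
pose w i (t : 'I_3) := [:: if i is 0 then 0 else b i; h i; a i]`_t.
apply: (tp_row_staircase (w := w) (phi := fun i t => (i.*2 + t).-1) (tp_diag1 S)).
- by move=> i [[|[|[|t]]] ltt]; rewrite /w //=; case: i => * /=; rewrite ?rpred0.
(* Rows i and i+1 both use the index 2i+1, so the staircase inequality is only weak. *)
- by move=> i i' [t ltt] [t' ltt'] /=; lia.
move=> i m; rewrite !big_ord_recl big_ord0 /= /w /bump /= /interleave /L1.
rewrite /lower_bidiag /infmx_diag !(addn0, addnS) addr0 /=.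
have := odd_double_half m; set n := m./2; case: (odd m) => /= <-.
  case: i => [|i]; do! (case: eqP => ?; try lia);
    by rewrite ?(mulr0, mul0r, mulr1, addr0, add0r); subst.
case: i => [|i]; do! (case: eqP => ?; try lia);
  by rewrite ?(mulr0, mul0r, mulr1, addr0, add0r); subst.
Qed.

(* The interleaved matrix is A K. *)
Lemma tp_interleave_tridiag_lower :
  totally_positive S (interleave (L1 * U + infmx_diag h)%IM L1).
Proof.
(* Odd columns of K are unit vectors: [phi] is then constant in [t], which keeps the staircase
   condition, and the weight selects [t = 0]. Even columns use the indices m-1, m, m+1; at m = 0 the
   truncated index has weight 0. *)
pose w m (t : 'I_3) := if odd m then (t == 0)%:R else
  [:: if m is 0 then 0 else c m./2; 1; d m./2]`_t.
pose phi m (t : 'I_3) := if odd m then m else (m + t).-1.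
apply: (tp_col_staircase (w := w) (phi := phi) tp_interleave_diag_lower).
- move=> m t; rewrite /w; case: odd; first by rewrite rpred_nat.
  by case: t => [[|[|[|t]]] ltt] //=; case: m => * /=; rewrite ?rpred0 ?rpred1.
- move=> m m' [t ltt] [t' ltt'] ltm; rewrite /phi /=.
  by case: ifP; case: ifP; lia.
move=> i m; rewrite !big_ord_recl big_ord0 /= /w /phi /bump /= /interleave.
have := odd_double_half m; set n := m./2; case: (odd m) => /= <-.
  rewrite /= odd_double /= !mul0r mul1r !addr0.
  by rewrite uphalf_double.
rewrite !(addn0, addnS) /= odd_double doubleK uphalf_double addr0.
rewrite /infmx_add infmx_mul_upper mul1r.
case: n => [|n]; first by rewrite mul0r add0r addr0 addrC mulrC.
by rewrite add0n /= odd_double uphalf_double /=; ring.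
Qed.

(** Grouping P as (L1 U + D2) L2 + L1 D1, its column j combines columns j and j+1 of L1 U + D2 with
    column j of L1; these sit at 2j, 2j+2 and 2j+1 after interleaving. *)
Lemma tp_quadridiagonal :
  totally_positive S (L1 * U * L2 + L1 * infmx_diag g + infmx_diag h * L2)%IM.
Proof.
pose w j (t : 'I_3) := [:: e j; g j; f j.+1]`_t.
apply: (tp_col_staircase (w := w) (phi := fun j t => (j.*2 + t)%N)
  tp_interleave_tridiag_lower).
- by move=> j [[|[|[|t]]] ltt]; rewrite /w /=.
- by move=> j j' [t ltt] [t' ltt'] /=; lia.
move=> i j; rewrite !big_ord_recl big_ord0 /= /w /bump /= /interleave.
rewrite !(addn0, addnS) /= odd_double doubleK uphalf_double addr0.
rewrite /infmx_add !infmx_mul_lower infmx_mul_diag.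
by rewrite /=; ring.
Qed.

End Quadridiagonal.

(** Testing only the finite support makes the condition boolean; all other coefficients vanish. *)
Definition nonneg_coeffs : {pred Zpoly} :=
  fun p => all (fun m => 0 <= p@_m) (msupp p).

Lemma nonneg_coeffsP (p : Zpoly) :
  reflect (coefficientwise_nonneg p) (p \in nonneg_coeffs).
Proof.
apply: (iffP allP) => [p_ge0 m | p_ge0 m _]; last exact: p_ge0.
have [/p_ge0 //|/mcoeff_outdom ->] := boolP (m \in msupp p).
exact: lexx.
Qed.

Lemma nonneg_coeffs_semiring : semiring_closed nonneg_coeffs.
Proof.
split; split.
- by apply/nonneg_coeffsP => m; rewrite mcoeff0.
- move=> p q /nonneg_coeffsP Sp /nonneg_coeffsP Sq; apply/nonneg_coeffsP => m.
  by rewrite mcoeffD addr_ge0.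
- by apply/nonneg_coeffsP => m; rewrite mcoeff1 ler0n.
move=> p q /nonneg_coeffsP Sp /nonneg_coeffsP Sq; apply/nonneg_coeffsP => m.
rewrite mcoeffMl; apply: sumr_ge0 => m1 _; apply: sumr_ge0 => m2 _.
by rewrite mulrn_wge0 ?mulr_ge0.
Qed.

HB.instance Definition _ :=
  GRing.isSemiringClosed.Build Zpoly nonneg_coeffs nonneg_coeffs_semiring.

Lemma nonneg_coeffs_X F n : X F n \in nonneg_coeffs.
Proof. by apply/nonneg_coeffsP => m; rewrite mcoeffU1 ler0n. Qed.

Theorem theorem6p1 :
  let L1 := lower_bidiag (X Fa) (X Fb) in
  let U  := upper_bidiag (X Fd) (X Fc) in
  let L2 := lower_bidiag (X Fe) (X Ff) in
  let D1 := infmx_diag (X Fg) in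
  let D2 := infmx_diag (X Fh) in
  coefficientwise_totally_positive (L1 * U * L2 + L1 * D1 + D2 * L2)%IM.
Proof.
move=> L1 U L2 D1 D2 k r c hr hc; apply/nonneg_coeffsP.
by apply: (tp_quadridiagonal (S := nonneg_coeffs)) => // n; apply: nonneg_coeffs_X.
Qed.
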